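(* Let $k\ge3$ and $2\le m\le k-1$ be integers. Put $$d=\min\{k-m,\,m-1\},\qquad E(m,k)=\left\lfloor\frac{md}{2}\right\rfloor.$$ Then for every integer $w\ge3$, $$\psi(w,k,m)\ \ge\ m\,\psi(w-1,k,m)+E(m,k)\,f(w-2,k).$$
   Context: All set families are finite families of distinct sets. A family is $w$-uniform if all its members have exactly $w$ elements (the ground set is an arbitrary finite set, not fixed). A $k$-sunflower is a collection of $k$ distinct sets $A_1,\dots,A_k$ for which there is a set $C$ (the core, possibly empty) with $A_i\cap A_j=C$ for all $i\ne j$. The matching number $\nu(\mathcal F)$ is the largest number of pairwise disjoint members of $\mathcal F$. For $w\ge1$, $k\ge2$, $f(w,k)$ denotes the maximum size of a $w$-uniform family containing no $k$-sunflower (finite by the Erdős–Rado sunflower lemma). For $m\ge2$, $\psi(w,k,m)$ denotes the maximum size of a $w$-uniform family $\mathcal F$ containing no $k$-sunflower and satisfying $\nu(\mathcal F)\le m-1$. *)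

(* Defs.v *)
From mathcomp Require Import all_boot.
From mathcomp Require Import boolp.

Set Implicit Arguments.
Unset Strict Implicit.
Unset Printing Implicit Defensive.

Section Families.
Variable T : finType.
Implicit Types (F S : {set {set T}}) (w k : nat).

Definition uniform w F : bool := [forall A in F, #|A| == w].

Definition sunflower k S : bool :=
  (#|S| == k) &&
  [exists C : {set T},
    [forall A in S, forall B in S, (A != B) ==> (A :&: B == C)]].

Definition sunflower_free k F : bool :=
  [forall S : {set {set T}}, (S \subset F) ==> ~~ sunflower k S].

Definition matching_number F : nat :=
  \max_(S : {set {set T}} | (S \subset F) && trivIset S) #|S|.

End Families.

Definition is_maximum (P : nat -> Prop) (n : nat) : Prop :=
  P n /\ forall n', P n' -> n' <= n.

(* The default value 0 is returned only if [P] has no maximum; by [fP] and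
   [psiP] below this does not happen for [f] and [psi] when [0 < k]. *)
Definition maximum (P : nat -> Prop) : nat :=
  if pselect (exists n, is_maximum P n) is left exP then projT1 (cid exP) else 0.

(* The ground set [T] is not fixed: it varies with the family. *)
Definition f_size (w k n : nat) : Prop :=
  exists (T : finType) (F : {set {set T}}),
    [/\ uniform w F, sunflower_free k F & #|F| = n].

Definition psi_size (w k m n : nat) : Prop :=
  exists (T : finType) (F : {set {set T}}),
    [/\ uniform w F, sunflower_free k F, matching_number F <= m - 1
      & #|F| = n].

Definition f (w k : nat) : nat := maximum (f_size w k).

Definition psi (w k m : nat) : nat := maximum (psi_size w k m).

Definition dmin (m k : nat) : nat := minn (k - m) (m - 1).

Definition E (m k : nat) : nat := (m * dmin m k) %/ 2.

Lemma maximumP (P : nat -> Prop) (b : nat) :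
  P 0 -> (forall n, P n -> n <= b) -> is_maximum P (maximum P).
Proof.
move=> P0 Pb; rewrite /maximum.
have exP : exists n, `[< P n >] by exists 0; apply/asboolP.
have ubP n : `[< P n >] -> n <= b by move/asboolP/Pb.
case: (ex_maxnP exP ubP) => n /asboolP Pn nmax.
case: pselect => [exM|[]]; first by case: (cid exM).
by exists n; split=> // n' Pn'; apply: nmax; apply/asboolP.
Qed.

Lemma exists_subset_card (T : finType) (S : {set T}) k :
  k <= #|S| -> exists2 S' : {set T}, S' \subset S & #|S'| = k.
Proof.
move=> kS; exists [set x in take k (enum S)].
  by apply/subsetP=> x; rewrite inE => /mem_take; rewrite mem_enum.
rewrite cardsE (card_uniqP _) ?take_uniq ?enum_uniq // size_take -cardE.
by case: ltngtP kS.
Qed.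

(* Erdos-Rado sunflower lemma. *)
Lemma sunflower_bound (T : finType) w k (F : {set {set T}}) :
  uniform w F -> sunflower_free k F -> #|F| <= w`! * k.-1 ^ w.
Proof.
elim: w F => [|w IHw] F /forallP uF /forallP sF.
  rewrite expn0 muln1 fact0 -[leqRHS](cards1 (set0 : {set T})).
  apply: subset_leq_card.
  apply/subsetP=> A AF; rewrite inE -cards_eq0.
  exact: (implyP (uF A)).
pose P (S : {set {set T}}) := (S \subset F) && trivIset S.
have P0 : P set0 by rewrite /P sub0set /trivIset /cover !big_set0 cards0.
have [S /maxsetP[/andP[SF tS] Smax] _] := maxset_exists P0.
have Sk : #|S| <= k.-1.
  rewrite leqNgt; apply/negP => kS.
  have [|S' S'S cS'] := @exists_subset_card _ S k.
    by apply: leq_trans kS; exact: leqSpred.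
  have := implyP (sF S') (subset_trans S'S SF); rewrite /sunflower cS' eqxx /=.
  case/existsP; exists set0.
  apply/forallP=> A; apply/implyP=> AS; apply/forallP=> B; apply/implyP=> BS.
  apply/implyP=> AB; rewrite setI_eq0.
  by apply: (trivIsetP tS) => //; apply: (subsetP S'S).
have Ycard : #|cover S| <= k.-1 * w.+1.
  rewrite -(eqP tS) (eq_bigr (fun=> w.+1)).
    by rewrite sum_nat_const leq_mul2r Sk orbT.
  by move=> A /(subsetP SF) AF; apply/eqP/(implyP (uF A)).
have meet A : A \in F -> exists2 y, y \in cover S & y \in A.
  move=> AF; have /eqP cA := implyP (uF A) AF.
  have An0 : A != set0 by rewrite -cards_eq0 cA.
  case: (boolP (A \in S)) => [AS|AS].
    have /set0Pn[y yA] := An0; exists y => //.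
    by apply/bigcupP; exists A.
  case: (boolP [disjoint A & cover S]) => [dA|]; last first.
    by rewrite -setI_eq0 => /set0Pn[y]; rewrite inE => /andP[yA yS]; exists y.
  have PA : P (A |: S).
    apply/andP; split; first by rewrite subUset sub1set AF.
    apply/trivIsetP => B C /setU1P[->|BS] /setU1P[->|CS] BC.
    - by rewrite eqxx in BC.
    - by apply: disjointWr dA; exact: bigcup_sup.
    - by rewrite disjoint_sym; apply: disjointWr dA; exact: bigcup_sup.
    - exact: (trivIsetP tS).
  by have := Smax _ PA (subsetUr _ _) => SA; rewrite -SA setU11 in AS.
pose Fy y := [set A in F | y \in A].
have FE : F = \bigcup_(y in cover S) Fy y.
  apply/setP=> A; apply/idP/bigcupP => [AF|[y _]].
    by have [y yS yA] := meet A AF; exists y; rewrite // inE AF.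
  by rewrite inE => /andP[].
have Fyb y : #|Fy y| <= w`! * k.-1 ^ w.
  pose L := [set A :\ y | A in Fy y].
  have <- : #|L| = #|Fy y|.
    apply: card_in_imset => A B; rewrite !inE => /andP[_ yA] /andP[_ yB] AB.
    by rewrite -(setD1K yA) AB setD1K.
  have LP A : A \in L -> (y \notin A) && (y |: A \in F).
    case/imsetP=> B; rewrite inE => /andP[BF yB] ->.
    by rewrite setD11 setD1K.
  apply: IHw; apply/forallP.
    move=> A; apply/implyP=> /LP /andP[yA /(implyP (uF _))].
    by rewrite cardsU1 yA.
  move=> S'; apply/implyP=> S'L; apply/negP=> /andP[cS' /existsP[C sC]].
  have S'P A : A \in S' -> (y \notin A) && (y |: A \in F).
    by move/(subsetP S'L)/LP.
  have yK A : A \in S' -> (y |: A) :\ y = A.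
    by move/S'P=> /andP[yA _]; rewrite setU1K.
  pose S2 := [set y |: A | A in S'].
  have S2F : S2 \subset F.
    by apply/subsetP=> B /imsetP[A /S'P /andP[_ AF] ->].
  have /negP := implyP (sF S2) S2F; apply; apply/andP; split.
    rewrite card_in_imset // => A B AS BS AB.
    by rewrite -(yK A AS) AB yK.
  apply/existsP; exists (y |: C).
  apply/forallP=> A; apply/implyP=> /imsetP[A' A'S ->].
  apply/forallP=> B; apply/implyP=> /imsetP[B' B'S ->].
  apply/implyP=> AB; rewrite -setUIr.
  have AB' : A' != B' by apply: contraNneq AB => ->.
  have /forall_inP /(_ _ A'S) /forall_inP /(_ _ B'S) /implyP := sC.
  by move=> /(_ AB') /eqP ->.
rewrite FE; apply: (@leq_trans (\sum_(y in cover S) #|Fy y|)).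
  apply: (big_ind2 (fun (X : {set {set T}}) n => #|X| <= n)).
  - by rewrite cards0.
  - move=> X1 n1 X2 n2 h1 h2.
    by apply: leq_trans (leq_add h1 h2); rewrite cardsU leq_subr.
  - by [].
apply: (@leq_trans (#|cover S| * (w`! * k.-1 ^ w))).
  by rewrite -sum_nat_const; apply: leq_sum.
apply: leq_trans (leq_mul Ycard (leqnn _)) _.
by rewrite factS expnS [k.-1 * _]mulnC mulnACA.
Qed.

Lemma sunflower_free0 (T : finType) k :
  0 < k -> sunflower_free k (set0 : {set {set T}}).
Proof.
move=> k0; apply/forallP=> S; apply/implyP; rewrite subset0 => /eqP ->.
by rewrite /sunflower cards0 eq_sym negb_and -lt0n k0.
Qed.

Lemma fP w k : 0 < k -> is_maximum (f_size w k) (f w k).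
Proof.
move=> k0; apply: (@maximumP _ (w`! * k.-1 ^ w)).
  exists 'I_0, set0; rewrite sunflower_free0 // cards0; split=> //.
  by apply/forallP=> A; rewrite inE.
by move=> n [T [F [uF sF <-]]]; exact: sunflower_bound.
Qed.

Lemma psiP w k m : 0 < k -> is_maximum (psi_size w k m) (psi w k m).
Proof.
move=> k0; apply: (@maximumP _ (w`! * k.-1 ^ w)).
  exists 'I_0, set0; rewrite sunflower_free0 // cards0; split=> //.
    by apply/forallP=> A; rewrite inE.
  apply/bigmax_leqP=> S /andP[]; rewrite subset0 => /eqP -> _.
  by rewrite cards0.
by move=> n [T [F [uF sF _ <-]]]; exact: sunflower_bound.
Qed.

(* Main.v *)
Require Import Defs.
From mathcomp Require Import all_boot all_algebra zify.

Set Implicit Arguments.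
Unset Strict Implicit.
Unset Printing Implicit Defensive.

Import GRing.Theory.

(** Take a graph on [m] vertices with maximum degree at most [d] and
    [m * d %/ 2] edges, an extremal family [G] for [psi (w - 1) k m] and an
    extremal family [H] for [f (w - 2) k].  The family consists of the sets
    [v |: A] for a vertex [v] and [A] in [G], and [e :|: B] for an edge [e] and
    [B] in [H], the same [G] and [H] being used for all vertices and edges.  In
    a [k]-sunflower the core contains one or two vertices, since [m < k].  If it
    contains two, the members all come from one edge, giving a sunflower in [H].
    If it is a single vertex, at most [d <= k - m] members come from edges: if
    there are none, [G] contains a sunflower; otherwise the core is just that
    vertex, and at least [m] pairwise disjoint members of [G] remain. *)

(** * Edges of circulant graphs *)

Section Circulant.
Variable V : finZmodType.
Implicit Types (v x y : V) (p : V * V).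
Local Open Scope ring_scope.

(** Arcs are encoded by start and difference so that edges can be counted one difference at a
    time. *)
Definition arc_edge p : {set V} := [set p.1; p.1 + p.2].

Variable D : {set V}.
(** The case [x = y] excludes 0, which gives loops, and elements of order two, which give each edge
    twice. *)
Hypothesis D_antisym : forall x y, x \in D -> y \in D -> x != - y.

Lemma card_arc_edge p : p.2 \in D -> #|arc_edge p| = 2%N.
Proof.
move=> pD; rewrite cards2 -[X in X == _]addr0 (inj_eq (addrI _)) eq_sym.
suff -> : p.2 != 0 by [].
by apply: contraNneq (D_antisym pD pD) => ->; rewrite oppr0.
Qed.

(** Arcs on the same edge either share their start, hence their difference, or are reverse to each
    other, which forces opposite differences. *)
Lemma arc_edge_inj : {in [pred p | p.2 \in D] &, injective arc_edge}.
Proof.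
move=> [x s] [y t]; rewrite !inE /= => sD tD eqe.
have /set2P[/= xy|/= xy] : x \in arc_edge (y, t) by rewrite -eqe set21.
- have : x + s \in arc_edge (y, t) by rewrite -eqe set22.
  rewrite xy => /set2P[/= st|/= /addrI -> //].
  have s0 : s = 0 by apply: (@addrI _ y); rewrite st addr0.
  by case/negP: (D_antisym sD sD); rewrite s0 oppr0.
- have : y \in arc_edge (x, s) by rewrite eqe set21.
  case/set2P => /= yx.
    have t0 : t = 0 by apply: (@addrI _ y); rewrite -xy yx addr0.
    by case/negP: (D_antisym tD tD); rewrite t0 oppr0.
  case/negP: (D_antisym sD tD); rewrite -addr_eq0; apply/eqP.
  by apply: (@addrI _ x); rewrite addr0 addrA -yx.
Qed.

(** An edge at [v] comes from an arc leaving [v] or from one arriving there, which starts at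
    [v - t]. *)
Lemma arc_degree (X : {set V * V}) v :
  {in X, forall p, p.2 \in D} ->
  (#|[set e in arc_edge @: X | v \in e]| <=
     \sum_(t in D) (((v, t) \in X)%R + ((v - t, t) \in X)%R))%N.
Proof.
move=> XD.
pose Y := [set (v, t) | t in D & (v, t) \in X] :|:
          [set (v - t, t) | t in D & (v - t, t) \in X].
apply: (@leq_trans #|arc_edge @: Y|).
  apply/subset_leq_card/subsetP=> e; rewrite inE => /andP[/imsetP[[x t] xX ->]].
  have tD := XD _ xX; case/set2P=> /= vE; apply/imsetP; exists (x, t) => //.
    by apply/setUP; left; apply/imsetP; exists t; rewrite ?vE // inE tD.
  have xE : x = v - t by rewrite vE addrK.
  by apply/setUP; right; apply/imsetP; exists t; rewrite ?xE // inE tD -xE.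
apply: leq_trans (leq_imset_card _ _) _; rewrite big_split /=.
have cE (P : pred V) : (\sum_(t in D) P t)%N = #|[pred t | (t \in D) && P t]|.
  by rewrite -sum1_card [RHS]big_mkcondr; apply: eq_bigr => t _; case: (P t).
rewrite !cE; apply: leq_trans (leq_card_setU _ _) _.
apply: leq_add; apply: leq_trans (leq_imset_card _ _) _; by rewrite cardsE.
Qed.

End Circulant.

(** * Near-regular graphs with the prescribed number of edges *)

Lemma card_pairs (I J : finType) (X : {set I * J}) :
  #|X| = \sum_j #|[set i | (i, j) \in X]|.
Proof.
under eq_bigr => j _ do rewrite -sum1dep_card big_mkcond.
rewrite exchange_big pair_bigA /= -sum1_card big_mkcond.
by apply: eq_bigr => -[].
Qed.

Lemma complete_graph m :
  exists Es : {set {set 'I_m}},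
    [/\ {in Es, forall e : {set 'I_m}, #|e| = 2},
        forall v, #|[set e in Es | v \in e]| <= m.-1
      & #|Es| = (m * m.-1) %/ 2].
Proof.
exists [set e : {set 'I_m} | #|e| == 2]; split=> [e|v|].
- by rewrite inE => /eqP.
(* An edge at [v] is determined by its other endpoint. *)
- have -> : m.-1 = #|[set~ v]| by rewrite cardsC1 card_ord.
  apply: leq_trans (leq_imset_card (fun u => [set v; u]) _).
  apply/subset_leq_card/subsetP=> e; rewrite !inE => /andP[/cards2P[x [y [xy ->]]]].
  case/set2P=> ->; apply/imsetP; first by exists y; rewrite // !inE eq_sym.
  by exists x; rewrite 1?setUC // !inE.
- by rewrite card_draws card_ord bin2 divn2.
Qed.

(* The circulant graph with differences 1, ..., h has degree 2h; when d is odd,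
   the Hamiltonian cycle of difference 1 is thinned out to the matching
   {0, 1}, {2, 3}, ..., which lowers each degree by at least one.  This needs
   2h < m, which fails for d = m - 1 odd: hence the separate case. *)
Lemma near_regular_graph m d : d < m ->
  exists Es : {set {set 'I_m}},
    [/\ {in Es, forall e : {set 'I_m}, #|e| = 2},
        forall v, #|[set e in Es | v \in e]| <= d
      & #|Es| = (m * d) %/ 2].
Proof.
case: m => // m; rewrite ltnS leq_eqVlt => /predU1P[->|dm].
  exact: complete_graph.
pose h := uphalf d; pose V : finZmodType := 'I_m.+1.
pose D : {set V} := [set t : V | 0 < (t : nat) <= h].
have h2 : h.*2 <= m by rewrite /h; lia.
have valD (x y : V) : (x + y)%R = (x + y) %% m.+1 :> nat by [].
(* No wrap-around: two differences have a positive sum of at most [h.*2], below the group order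
   [m.+1]. *)
have anti (x y : V) : x \in D -> y \in D -> (x != - y)%R.
  rewrite !inE => xD yD; rewrite -addr_eq0 -val_eqE /= modn_small; lia.
have cD : #|D| = h.
  rewrite -[RHS]card_ord -(card_image (f := fun i : 'I_h => inord i.+1 : V)).
    apply: eq_card => t; rewrite inE; apply/idP/imageP=> [tD|[i _ ->]].
      have th : (t : nat).-1 < h by lia.
      by exists (Ordinal th) => //=; apply: val_inj; rewrite /= inordK; lia.
    by have ih := ltn_ord i; rewrite inordK; lia.
  move=> i j /(congr1 val) /=; have ih := ltn_ord i; have jh := ltn_ord j.
  by rewrite !inordK; [move=> [] /ord_inj | lia..].
(* Starts of the matching edges; [i < m] drops the last vertex, whose arc of difference 1 would wrap
   to 0. *)
pose keep (i : V) := ~~ odd i && (i < m).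
pose X : {set V * V} := [set p | (p.2 \in D) &&
  (odd d && (p.2 == inord 1) ==> keep p.1)].
have XD : {in X, forall p, p.2 \in D} by move=> p; rewrite inE => /andP[].
have double_lt n : n < m.+1./2 -> n.*2 < m.+1 by lia.
have ckeep : #|[set i | keep i]| = m.+1./2.
  rewrite -[RHS]card_ord -(card_image (f := fun i : 'I_(m.+1./2) => inord i.*2 : V)).
    apply: eq_card => t; rewrite inE; apply/idP/imageP=> [tk|[i _ ->]].
      have th : (t : nat)./2 < m.+1./2 by rewrite /keep in tk; lia.
      exists (Ordinal th) => //=; apply: val_inj; rewrite /= inordK /keep in tk *; lia.
    by have ih := ltn_ord i; rewrite /keep inordK; lia.
  move=> i j /(congr1 val) /=; have ih := ltn_ord i; have jh := ltn_ord j.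
  by rewrite !inordK; [move=> /double_inj /ord_inj | exact: double_lt..].
exists [set arc_edge p | p in X]; split=> [_ /imsetP[p /XD pD ->]|v|].
- exact: card_arc_edge anti _ pD.
- apply: leq_trans (arc_degree v XD) _.
  case od: (odd d); last first.
    apply: (@leq_trans (\sum_(t in D) 2)); first by apply: leq_sum => t _; lia.
    by rewrite sum_nat_const cD /h; lia.
  have oD : (inord 1 : V) \in D by rewrite inE inordK /h; lia.
  rewrite (big_setD1 _ oD) /=.
  (* Difference 1 contributes at most 1, the other [h - 1] differences at most 2 each, and
     [d = 2h - 1]. *)
  apply: (@leq_trans (1 + \sum_(t in D :\ (inord 1 : V)) 2)).
    apply: leq_add.
      (* Otherwise [v - 1] and [v] are both even, although [v - 1 < m] rules out a wrap-around. *)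
      have no : ~ ((v, inord 1) \in X /\ ((v - inord 1)%R, inord 1) \in X).
        rewrite !inE /= !od /= !inordK /=; last lia; move=> [/andP[_ kv] /andP[_ ku]].
        have : v = (v - inord 1 + inord 1)%R by rewrite subrK.
        move/(congr1 (@nat_of_ord _)); rewrite valD inordK; last lia.
        move: kv ku; rewrite eqxx /keep; set u := nat_of_ord (v - _)%R => /= kv ku.
        by rewrite modn_small; lia.
      by move: no; case: (_ \in X); case: (_ \in X) => // -[].
    by apply: leq_sum => t _; lia.
  by rewrite sum_nat_const; have := cardsD1 (inord 1 : V) D; rewrite oD cD /h; lia.
- rewrite card_in_imset; last by move=> p q /XD pX /XD qX; apply: (arc_edge_inj anti).
  rewrite card_pairs (bigID (mem D)) /= [X in _ + X]big1 ?addn0; last first.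
    move=> t tD; apply/eqP; rewrite cards_eq0; apply/eqP/setP=> i.
    by rewrite in_set in_set0; apply: contraNF tD => /XD.
  have full (t : V) : t \in D -> ~~ (odd d && (t == inord 1)) ->
      #|[set i | (i, t) \in X]| = m.+1.
    move=> tD nt; rewrite -[RHS](card_ord m.+1) -cardsT; congr #|pred_of_set _|.
    by apply/setP=> i; rewrite in_setT in_set [LHS]in_set tD /= (negbTE nt).
  case od: (odd d); last first.
    rewrite (eq_bigr (fun=> m.+1)) => [|t tD]; last by rewrite full // od.
    have dE : d = h.*2 by rewrite /h; lia.
    by rewrite sum_nat_const cD [in RHS]dE -doubleMr divn2 doubleK mulnC.
  have oD : (inord 1 : V) \in D by rewrite inE inordK /h; lia.
  rewrite (big_setD1 _ oD) /= (eq_bigr (fun=> m.+1)) => [|t /setD1P[t1 tD]]; last first.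
    by rewrite full // (negbTE t1) andbF.
  have -> : #|[set i | (i, inord 1 : V) \in X]| = m.+1./2.
    rewrite -ckeep; congr #|pred_of_set _|; apply/setP=> i.
    by rewrite [RHS]in_set in_set [LHS]in_set oD /= od eqxx.
  (* The thinned difference has [m.+1./2] arcs, each of the other [d./2] has [m.+1]; the sum is
     [(m.+1 * d) %/ 2]. *)
  rewrite sum_nat_const; have := cardsD1 (inord 1 : V) D; rewrite oD cD => c1.
  have -> : #|D :\ (inord 1 : V)| = d./2 by rewrite /h in c1; lia.
  have dE : d = d./2.*2.+1 by lia.
  rewrite [in RHS]dE [in RHS]mulnS -doubleMr [_ * d./2]mulnC; set q := _ * _; lia.
Qed.

(** * Disjoint sets, sunflowers and matchings under projections *)

Lemma sum_card_disjoint (X V : finType) (S : {set X}) (P : X -> {set V}) :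
  {in S &, forall x y, x != y -> P x :&: P y = set0} ->
  \sum_(x in S) #|P x| <= #|V|.
Proof.
move=> dP.
(* Double counting: by disjointness each [v] lies in at most one [P x]. *)
have -> : \sum_(x in S) #|P x| = \sum_v #|[set x in S | v \in P x]|.
  under eq_bigr => x _ do rewrite -sum1_card big_mkcond /=.
  rewrite exchange_big; apply: eq_bigr => v _.
  by rewrite -sum1dep_card big_mkcondr.
rewrite -sum1_card; apply: leq_sum => v _.
rewrite leqNgt; apply/negP=> /card_gt1P[x [y []]].
rewrite !inE => /andP[xS vx] /andP[yS vy] xy.
by have /setP/(_ v) := dP _ _ xS yS xy; rewrite !inE vx vy.
Qed.

Lemma sunflowerP (T : finType) k (S : {set {set T}}) :
  reflect (#|S| = k /\ exists C, {in S &, forall A B, A != B -> A :&: B = C})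
          (sunflower k S).
Proof.
apply: (iffP andP) => [[/eqP cS /existsP[C sC]]|[cS [C sC]]]; split=> //.
- exists C => A B AS BS AB; apply/eqP.
  by have /forall_inP/(_ _ AS)/forall_inP/(_ _ BS)/implyP/(_ AB) := sC.
- exact/eqP.
- apply/existsP; exists C; apply/forall_inP=> A AS; apply/forall_inP=> B BS.
  by apply/implyP=> AB; apply/eqP/sC.
Qed.

Section Sunflower.
Variables (T T' : finType).
Implicit Types (S F : {set {set T}}) (p : T' -> T).

(** Preimages commute with intersections, so the core is pulled back too; injectivity on [S] keeps
    the number of petals. *)
Lemma sunflower_preimset k S p :
  {in S &, forall A B : {set T}, p @^-1: A = p @^-1: B -> A = B} -> sunflower k S ->
  sunflower k [set p @^-1: A | A : {set T} in S].
Proof.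
move=> inj /sunflowerP[cS [C sC]]; apply/sunflowerP; split.
  by rewrite card_in_imset.
exists (p @^-1: C) => _ _ /imsetP[A AS ->] /imsetP[B BS ->] AB.
rewrite -preimsetI sC //; by apply: contraNneq AB => ->.
Qed.

Lemma matching_number_le F n :
  (forall S, S \subset F -> trivIset S -> #|S| <= n) <-> matching_number F <= n.
Proof.
split=> [h|/bigmax_leqP h S SF tS]; last by apply: h; rewrite SF.
by apply/bigmax_leqP=> S /andP[]; apply: h.
Qed.

Lemma card_disjoint_image_le (X : finType) F n (S : {set X}) (g : X -> {set T}) :
  matching_number F <= n -> {in S &, injective g} ->
  {in S, forall x, g x \in F} ->
  {in S &, forall x y, x != y -> g x :&: g y = set0} -> #|S| <= n.
Proof.
move=> /matching_number_le nuF inj gF dg; rewrite -(card_in_imset inj).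
apply: nuF.
  by apply/subsetP=> _ /imsetP[x xS ->]; apply: gF.
apply/trivIsetP=> _ _ /imsetP[x xS ->] /imsetP[y yS ->] xy.
rewrite -setI_eq0; apply/eqP/dg => //; by apply: contraNneq xy => ->.
Qed.

End Sunflower.

(** * The family built from a graph and two set families *)

Section Join.
Variables (V T1 T2 : finType).
Notation T := (V + (T1 + T2))%type.
Implicit Types (I e : {set V}) (A : {set T1}) (B : {set T2}) (Z C : {set T}).

(** The three ground sets are kept disjoint, so that a sunflower can be studied through its traces
    [vp], [ap] and [bp]. *)
Definition pack I A B : {set T} :=
  [set u | match u with
           | inl v => v \in I | inr (inl a) => a \in A | inr (inr b) => b \in B
           end].

Let vp Z : {set V} := inl @^-1: Z.
Let ap Z : {set T1} := (inr \o inl) @^-1: Z.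
Let bp Z : {set T2} := (inr \o inr) @^-1: Z.

Lemma vp_pack I A B : vp (pack I A B) = I.
Proof. by apply/setP=> x; rewrite !inE. Qed.

Lemma ap_pack I A B : ap (pack I A B) = A.
Proof. by apply/setP=> x; rewrite !inE. Qed.

Lemma bp_pack I A B : bp (pack I A B) = B.
Proof. by apply/setP=> x; rewrite !inE. Qed.

Lemma card_pack I A B : #|pack I A B| = #|I| + #|A| + #|B|.
Proof.
rewrite -sum1_card big_mkcond !big_sumType /= -!big_mkcond /= addnA -!sum1_card.
congr (_ + _ + _); apply: eq_bigl => x; by rewrite inE.
Qed.

Variables (Es : {set {set V}}) (G : {set {set T1}}) (H : {set {set T2}}).
Hypothesis Es2 : {in Es, forall e : {set V}, #|e| = 2}.

Definition join : {set {set T}} :=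
  [set pack [set x.1] x.2 set0 | x in setX [set: V] G] :|:
  [set pack x.1 set0 x.2 | x in setX Es H].

Lemma joinP Z : Z \in join ->
  (exists v A, A \in G /\ Z = pack [set v] A set0) \/
  (exists e B, [/\ e \in Es, B \in H & Z = pack e set0 B]).
Proof.
case/setUP=> /imsetP[[x y]] /setXP[/= xP yP] ->; first by left; exists x, y.
by right; exists x, y.
Qed.

(** The two kinds of members cannot coincide: their vertex parts have sizes 1 and 2. *)
Lemma card_join : #|join| = #|V| * #|G| + #|Es| * #|H|.
Proof.
rewrite cardsU disjoint_setI0 ?cards0 ?subn0.
  rewrite !card_imset ?cardsX ?cardsT //.
    by move=> [e B] [e' B'] /= eqZ; rewrite -(vp_pack e set0 B) eqZ vp_pack
      -(bp_pack e set0 B) eqZ bp_pack.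
  move=> [v A] [v' A'] /= eqZ.
  by rewrite -(ap_pack [set v] A set0) eqZ ap_pack (set1_inj (_ : [set v] = [set v']))
    // -(vp_pack [set v] A set0) eqZ vp_pack.
rewrite disjoint_subset; apply/subsetP=> _ /imsetP[[v A] _ ->] /=.
apply/negP=> /imsetP[[e B] /setXP[/= eE _] /(congr1 vp)].
by rewrite !vp_pack => ev; have := Es2 eE; rewrite -ev cards1.
Qed.

Lemma uniform_join w : uniform w.+1 G -> uniform w H -> uniform w.+2 join.
Proof.
move=> /forall_inP uG /forall_inP uH; apply/forall_inP=> Z.
case/joinP=> [[v [A [AG ->]]]|[e [B [eE BH ->]]]]; rewrite card_pack cards0.
  by rewrite cards1 addn0 (eqP (uG _ AG)).
by rewrite (Es2 eE) (eqP (uH _ BH)).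
Qed.

Lemma join_vp_gt0 Z : Z \in join -> 0 < #|vp Z|.
Proof.
case/joinP=> [[v [A [AG ->]]]|[e [B [eE BH ->]]]]; rewrite vp_pack ?cards1 //.
by rewrite Es2.
Qed.

(* m disjoint members use up all vertices, one each, so they all come from G. *)
Lemma matching_number_join w :
  0 < #|V| -> uniform w.+1 G -> matching_number G <= #|V| - 1 ->
  matching_number join <= #|V| - 1.
Proof.
move=> V0 /forall_inP uG nuG; apply/matching_number_le => S /subsetP SJ tS.
have dS (p' : finType) (p : p' -> T) :
    {in S &, forall Z Z', Z != Z' -> p @^-1: Z :&: p @^-1: Z' = set0}.
  move=> Z Z' ZS Z'S ZZ'; rewrite -preimsetI.
  by have := trivIsetP tS _ _ ZS Z'S ZZ'; rewrite -setI_eq0 => /eqP->; rewrite preimset0.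
have [/exists_inP[Z ZS Z2]|/exists_inPn no2] :=
    boolP [exists Z in S, 2 <= #|vp Z|].
  have le : \sum_(Y in S) #|vp Y| <= #|V| := sum_card_disjoint (dS _ inl).
  (* [Z] uses two vertices and every other member at least one, so [S] has fewer members than there
     are vertices. *)
  have ge : #|S :\ Z| <= \sum_(Y in S :\ Z) #|vp Y|.
    by rewrite -sum1_card; apply: leq_sum => Y /setD1P[_ /SJ /join_vp_gt0].
  rewrite (big_setD1 Z) //= in le.
  have := leq_sub2r 1 (leq_trans (leq_add Z2 ge) le).
  by rewrite addSn subSS subn0 (cardsD1 Z S) ZS.
have SG Z : Z \in S -> ap Z \in G.
  move=> ZS; have := no2 _ ZS.
  case/joinP: (SJ _ ZS) => [[v [A [AG ->]]]|[e [B [eE BH ->]]]].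
    by rewrite ap_pack.
  by rewrite vp_pack Es2.
apply: (card_disjoint_image_le (g := ap) nuG) => //; last exact: dS.
(* Equal disjoint traces would be empty, but members of [G] have [w.+1] elements. *)
move=> Z Z' ZS Z'S eqA; apply/eqP; apply: contraT => ZZ'.
have := dS _ (inr \o inl) Z Z' ZS Z'S ZZ'; rewrite -/(ap Z) -/(ap Z') eqA setIid.
by have := eqP (uG _ (SG _ Z'S)) => cZ /eqP; rewrite -cards_eq0 cZ.
Qed.

Lemma sunflower_free_join k d :
  1 < k -> #|V| < k -> d + #|V| <= k ->
  (forall v, #|[set e in Es | v \in e]| <= d) ->
  matching_number G <= #|V| - 1 ->
  sunflower_free k G -> sunflower_free k H -> sunflower_free k join.
Proof.
move=> k1 Vk dk deg nuG /forallP sG /forallP sH.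
apply/forallP=> S; apply/implyP=> /subsetP SJ; apply/negP=> sS.
have /sunflowerP[cS [C sC]] := sS.
have sP (p' : finType) (p : p' -> T) : {in S &, forall Z Z', Z != Z' ->
    p @^-1: Z :&: p @^-1: Z' = p @^-1: C}.
  by move=> Z Z' ZS Z'S ZZ'; rewrite -preimsetI sC.
have CS Z : Z \in S -> C \subset Z.
  move=> ZS; have : 0 < #|S :\ Z| by move: k1; rewrite -cS (cardsD1 Z S) ZS.
  case/card_gt0P=> Y /setD1P[YZ YS]; rewrite -(sC Y Z) //; exact: subsetIr.
have vCS Z : Z \in S -> vp C \subset vp Z by move/CS/preimsetS; apply.
(* Without a vertex in the core, the [k] nonempty vertex parts would be disjoint, with fewer than
   [k] vertices available. *)
have [C0|[i iC]] := set_0Vmem (vp C).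
  have : \sum_(Z in S) #|vp Z| <= #|V|.
    by apply: sum_card_disjoint => Z Z' ZS Z'S ZZ'; rewrite -C0; apply: sP.
  have : \sum_(Z in S) 1 <= \sum_(Z in S) #|vp Z|.
    by apply: leq_sum => Z /SJ /join_vp_gt0.
  rewrite sum1_card cS => h1 h2; have := leq_trans h1 h2; lia.
have [C1|C2] := leqP #|vp C| 1; last first.
  (* A core with two vertices contains the whole edge of every member. *)
  have SH Z : Z \in S -> exists2 B, B \in H & Z = pack (vp C) set0 B.
    move=> ZS; have := vCS _ ZS.
    case/joinP: (SJ _ ZS) => [[v [A [AG ->]]]|[e [B [eE BH ->]]]].
      by rewrite vp_pack => /subset_leq_card; rewrite cards1; lia.
    rewrite vp_pack => Ce; exists B => //; congr pack; apply/esym/eqP.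
    by rewrite eqEcard Ce (Es2 eE).
  have sub : [set bp Z | Z in S] \subset H.
    by apply/subsetP=> _ /imsetP[Z /SH[B BH ->] ->]; rewrite bp_pack.
  apply: (negP (implyP (sH _) sub)).
  apply: sunflower_preimset sS => Z Z' /SH[B BH ->] /SH[B' BH' ->].
  by rewrite -/(bp _) -/(bp _) !bp_pack => ->.
have Ci : vp C = [set i] by apply/esym/eqP; rewrite eqEcard sub1set iC cards1.
(* [S2] collects the members from edges through [i], [S1] those from the vertex [i]. *)
pose S2 := [set Z in S | vp Z != [set i]]; pose S1 := S :\: S2.
have S1P Z : Z \in S1 -> exists2 A, A \in G & Z = pack [set i] A set0.
  rewrite !inE => /andP[/[swap] ZS]; rewrite ZS /= negbK => /eqP vZ.
  case/joinP: (SJ _ ZS) vZ => [[v [A [AG ->]]]|[e [B [eE BH ->]]]].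
    by rewrite vp_pack => ->; exists A.
  by rewrite vp_pack => ei; have := Es2 eE; rewrite ei cards1.
have S2P Z : Z \in S2 -> exists e B, [/\ e \in Es, i \in e & Z = pack e set0 B].
  rewrite !inE => /andP[ZS vZ].
  case/joinP: (SJ _ ZS) (vCS _ ZS) vZ => [[v [A [AG ->]]]|[e [B [eE BH ->]]]];
    rewrite vp_pack Ci sub1set; last by exists e, B.
  by rewrite inE => /eqP->; rewrite eqxx.
have S1S : S1 \subset S by apply: subsetDl.
have S2S : S2 \subset S by apply/subsetP=> Z; rewrite inE => /andP[].
have inj1 : {in S1 &, injective ap}.
  by move=> Z Z' /S1P[A _ ->] /S1P[A' _ ->]; rewrite !ap_pack => ->.
(* Two members over the same edge would put both its ends in the core, so distinct members of [S2]
   have distinct edges at [i]. *)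
have cS2 : #|S2| <= d.
  rewrite -(@card_in_imset _ _ vp).
    apply: leq_trans (deg i); apply/subset_leq_card/subsetP=> _ /imsetP[Z ZS2 ->].
    by have [e [B [eE ie ->]]] := S2P _ ZS2; rewrite vp_pack inE eE.
  move=> Z Z' ZS2 Z'S2 eqv; apply/eqP; apply: contraT => ZZ'.
  have := sP _ inl Z Z' (subsetP S2S _ ZS2) (subsetP S2S _ Z'S2) ZZ'.
  rewrite -/(vp Z) -/(vp Z') -/(vp C) eqv setIid Ci => vi.
  by move: Z'S2; rewrite inE vi eqxx andbF.
have cS12 : #|S1| = k - #|S2| by rewrite cardsDS // cS.
have [S20|[Y YS2]] := set_0Vmem S2.
  have S1E : S1 = S by rewrite /S1 S20 setD0.
  rewrite S1E in S1P inj1.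
  have sub : [set ap Z | Z in S] \subset G.
    by apply/subsetP=> _ /imsetP[Z /S1P[A AG ->] ->]; rewrite ap_pack.
  apply: (negP (implyP (sG _) sub)).
  exact: sunflower_preimset sS.
(* The edge member [Y] of [S] avoids [T1], hence so does the core. *)
have aC : ap C = set0.
  apply/eqP; rewrite -subset0.
  have [e [B [_ _ YE]]] := S2P _ YS2.
  by rewrite -(ap_pack e set0 B) -YE; apply: preimsetS; apply/CS/(subsetP S2S).
(* The traces of [S1] on [T1] are now disjoint members of [G], yet [#|S1| >= k - d >= #|V|]. *)
have : #|S1| <= #|V| - 1.
  apply: (card_disjoint_image_le (g := ap) nuG) => //.
    by move=> Z /S1P[A AG ->]; rewrite ap_pack.
  move=> Z Z' ZS Z'S ZZ'; rewrite -aC.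
  by apply: sP => //; apply: (subsetP S1S).
have : 0 < #|V| by apply/card_gt0P; exists i.
lia.
Qed.

End Join.

Theorem theoremA2 (k m w : nat) (hk : 3 <= k) (hm : 2 <= m <= k - 1)
    (hw : 3 <= w) :
  m * psi (w - 1) k m + E m k * f (w - 2) k <= psi w k m.
Proof.
have k0 : 0 < k by lia.
have [[T1 [G [uG sG nuG <-]]] _] := psiP (w - 1) m k0.
have [[T2 [H [uH sH <-]]] _] := fP (w - 2) k0.
(* The bound [m - 1] in [dmin] makes the graph exist; the bound [k - m] serves sunflower-freeness
   below. *)
have dm : dmin m k < m by rewrite /dmin; lia.
have [Es [Es2 deg cE]] := near_regular_graph dm.
have [_ ub] := psiP w m k0; apply: ub.
exists ('I_m + (T1 + T2))%type, (join Es G H); split.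
- have wE : w = (w - 3).+3 by lia.
  rewrite wE; apply: uniform_join => //.
    by have -> : (w - 3).+2 = w - 1 by lia.
  by have -> : (w - 3).+1 = w - 2 by lia.
- apply: (@sunflower_free_join _ _ _ _ _ _ Es2 k (dmin m k)) => //; rewrite ?card_ord //; try lia.
  by rewrite /dmin; lia.
- rewrite -[X in X - 1](card_ord m); apply: (@matching_number_join _ _ _ _ _ _ Es2 (w - 2));
    rewrite ?card_ord //; first lia.
  by have -> : (w - 2).+1 = w - 1 by lia.
- by rewrite card_join // card_ord cE.
Qed.
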